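(* Let $0\le\rho<1$ and let $X$, $Y$ be real Banach spaces such that $\beta(Y)\le\rho$. Then for every $\varepsilon\in(0,1)$ $$\Phi^S(X,Y,\varepsilon)\le\Phi(X,Y,\varepsilon)\le\min\left\{\sqrt{2\varepsilon}\,\sqrt{\frac{1+\rho}{1-\rho}},\ 2\right\}.$$
   Context: All Banach spaces are real. $B_X$, $S_X$ denote the closed unit ball and unit sphere of $X$; $L(X,Y)$ is the space of bounded linear operators $X\to Y$ with the operator norm; $X^*=L(X,\mathbb{R})$. Property $\beta$: a Banach space $Y$ has property $\beta$ with parameter $\rho$, $0\le\rho<1$ (written $\beta(Y)\le\rho$), if there are two sets $\{y_\alpha:\alpha\in\Lambda\}\subset S_Y$ and $\{y^*_\alpha:\alpha\in\Lambda\}\subset S_{Y^*}$ such that (i) $y^*_\alpha(y_\alpha)=1$ for all $\alpha$; (ii) $|y^*_\alpha(y_\gamma)|\le\rho$ whenever $\alpha\ne\gamma$; (iii) $\|y\|=\sup\{|y^*_\alpha(y)|:\alpha\in\Lambda\}$ for all $y\in Y$. Bishop-Phelps-Bollobás modulus: for $\varepsilon\in(0,1)$, $\Phi(X,Y,\varepsilon)$ is the infimum of those $\delta>0$ such that for every $(x,T)\in B_X\times B_{L(X,Y)}$ with $\|T(x)\|>1-\varepsilon$ there is $(z,F)\in S_X\times S_{L(X,Y)}$ with $\|F(z)\|=1$, $\|x-z\|<\delta$ and $\|T-F\|<\delta$. The spherical modulus $\Phi^S(X,Y,\varepsilon)$ is defined in the same way with $(x,T)\in S_X\times S_{L(X,Y)}$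 in place of $(x,T)\in B_X\times B_{L(X,Y)}$. *)

(* Defs.v *)
From HB Require Import structures.
From mathcomp Require Import all_boot all_order all_algebra.
From mathcomp Require Import all_classical all_reals.
From mathcomp Require Import ereal topology normedtype.

Set Implicit Arguments.
Unset Strict Implicit.
Unset Printing Implicit Defensive.

Import Order.TTheory GRing.Theory Num.Theory.
Import numFieldNormedType.Exports.

Local Open Scope classical_set_scope.
Local Open Scope ring_scope.

Definition unit_ball (R : realType) (X : normedModType R) : set X :=
  [set x | `|x| <= 1].

Definition unit_sphere (R : realType) (X : normedModType R) : set X :=
  [set x | `|x| = 1].

Arguments unit_ball {R} X.
Arguments unit_sphere {R} X.

(* [linear_boundedP] turns this into [`|T x| <= r * `|x|] for all large [r]. *)
Definition bounded_operator (R : realType) (X Y : normedModType R)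
    (T : {linear X -> Y}) : Prop :=
  bounded_near T (nbhs (0 : X)).

(* [sup] is [0] on unbounded sets, so this is the operator norm only for
   operators satisfying [bounded_operator]; below it is only applied to these
   and to their differences. *)
Definition opnorm (R : realType) (X Y : normedModType R) (T : X -> Y) : R :=
  sup [set `|T x| | x in unit_ball X].

Definition op_ball (R : realType) (X Y : normedModType R) :
    set {linear X -> Y} :=
  [set T | bounded_operator T /\ opnorm T <= 1].

Definition op_sphere (R : realType) (X Y : normedModType R) :
    set {linear X -> Y} :=
  [set T | bounded_operator T /\ opnorm T = 1].

Arguments op_ball {R} X Y.
Arguments op_sphere {R} X Y.

(* If [Y] is the zero space the index type [L] is empty and the supremum over
   the empty family is [0]. *)
Definition property_beta (R : realType) (Y : normedModType R) (rho : R) :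
    Prop :=
  0 <= rho < 1 /\
  exists (L : Type) (y : L -> Y) (ys : L -> {linear Y -> R^o}),
    [/\ forall a : L, unit_sphere Y (y a) /\ op_sphere Y R^o (ys a),
        forall a : L, ys a (y a) = 1,
        forall a c : L, a <> c -> `|ys a (y c)| <= rho
      & forall v : Y, `|v| = sup [set `|ys a v| | a in [set: L]]].

Definition bpb_admissible (R : realType) (X Y : normedModType R)
    (A : set X) (B : set {linear X -> Y}) (eps delta : R) : Prop :=
  0 < delta /\
  forall (x : X) (T : {linear X -> Y}), A x -> B T -> `|T x| > 1 - eps ->
    exists (z : X) (F : {linear X -> Y}),
      [/\ unit_sphere X z, op_sphere X Y F, `|F z| = 1,
          `|x - z| < delta & opnorm (T \- F) < delta].

(* The infimum is taken in the extended reals, where [inf set0 = +oo]; the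
   infimum of the library in [R] would be [0] there. *)
Definition bpb_modulus (R : realType) (X Y : normedModType R) (eps : R) :
    \bar R :=
  ereal_inf [set delta%:E |
    delta in bpb_admissible (unit_ball X) (op_ball X Y) eps].

Definition bpb_spherical_modulus (R : realType) (X Y : normedModType R)
    (eps : R) : \bar R :=
  ereal_inf [set delta%:E |
    delta in bpb_admissible (unit_sphere X) (op_sphere X Y) eps].

Arguments bpb_modulus {R} X Y eps.
Arguments bpb_spherical_modulus {R} X Y eps.

(* Main.v *)
(* A functional almost attaining its norm at [x] is first moved, by the
   Bishop-Phelps theorem, to one attaining its norm at a nearby [z]; the two
   errors can be traded against each other through a parameter [k].  By
   property beta some [f = y*_a o T] is such a functional.  If [g] of norm one is
   close to [f] and attains its norm at [z], then
   [T + ((1 + eta) g - f) y_a] has [a]-th coordinate [(1 + eta) g], while its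
   other coordinates have norm at most [1 + rho (|g - f| + eta)], which is
   [1 + eta] for [eta = rho |g - f| / (1 - rho)]; so after normalization it
   attains its norm at [z].  Optimizing [k] gives the constant. *)
Require Import Defs.
From HB Require Import structures.
From mathcomp Require Import all_boot all_order all_algebra.
From mathcomp Require Import all_classical all_reals.
From mathcomp Require Import ereal topology normedtype.
From mathcomp Require Import ring lra.
Set Implicit Arguments.
Unset Strict Implicit.
Unset Printing Implicit Defensive.

Import Order.TTheory GRing.Theory Num.Theory.
Import numFieldNormedType.Exports.
Local Open Scope classical_set_scope.
Local Open Scope ring_scope.

(** * Sublinear functionals and the Hahn-Banach theorem *)

Lemma linear_pack (R : pzRingType) (U V : lmodType R) (f : U -> V) :
  linear f -> exists g : {linear U -> V}, g =1 f.
Proof.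
move=> lf; pose L := GRing.isLinear.Build R U V _ f lf.
by pose g : {linear U -> V} := HB.pack f L; exists g.
Qed.

(* The second clause at [t] and at [t^-1] gives positive homogeneity. *)
Definition sublinear (R : realType) (X : lmodType R) (q : X -> R) : Prop :=
  (forall u v, q (u + v) <= q u + q v) /\
  (forall (t : R) v, 0 <= t -> q (t *: v) <= t * q v).

(** A cone in [X * R]; a pair [(w, c)] in it encodes the demand [c <= h w] on a functional [h]. *)
Definition convex_cone (R : realType) (X : lmodType R) (K : X -> R -> Prop) :
    Prop :=
  [/\ K 0 0,
      forall u a v b, K u a -> K v b -> K (u + v) (a + b)
    & forall (t : R) u a, 0 < t -> K u a -> K (t *: u) (t * a)].

(** If [q] is sublinear, [K] is a convex cone and [c <= q w] on [K], the linear functionals below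
    this one are exactly those that lie below [q] and meet all demands of [K]. *)
Definition inf_convolution (R : realType) (X : lmodType R) (q : X -> R)
    (K : X -> R -> Prop) (v : X) : R :=
  inf [set r | exists w c, K w c /\ r = q (v + w) - c].

Section sublinear_theory.
Context (R : realType) (X : lmodType R).
Implicit Types (q : X -> R) (K : X -> R -> Prop).

Lemma sublinear0 q : sublinear q -> q 0 = 0.
Proof.
move=> [qD qZ]; apply/eqP; rewrite eq_le.
have := qZ 0 0 (lexx _); rewrite scale0r mul0r => -> /=.
by have := qD 0 0; rewrite addr0; lra.
Qed.

Lemma sublinearN q v : sublinear q -> - q (- v) <= q v.
Proof.
move=> qs; have [qD _] := qs.
by have := qD v (- v); rewrite subrr sublinear0//; lra.
Qed.

Lemma sublinearZ q t v : sublinear q -> 0 <= t -> q (t *: v) = t * q v.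
Proof.
move=> qs; have [_ qZ] := qs; rewrite le_eqVlt => /orP[/eqP<-|t0].
  by rewrite scale0r mul0r sublinear0.
apply/eqP; rewrite eq_le (qZ _ _ (ltW t0)) /= -ler_pdivlMl//.
by have := qZ t^-1 (t *: v); rewrite scalerK ?gt_eqF// invr_ge0 ltW//; exact.
Qed.

Section inf_convolution.
Context (q : X -> R) (K : X -> R -> Prop).
Hypotheses (qs : sublinear q) (Kc : convex_cone K).
Hypothesis Kq : forall w c, K w c -> c <= q w.

Lemma inf_convolution_le v w c : K w c -> inf_convolution q K v <= q (v + w) - c.
Proof.
move=> Kwc; apply: ge_inf; last by exists w, c.
(* From [c' <= q w' <= q (v + w') + q (- v)]: the set is bounded below, so [inf] is a genuine
   infimum. *)
exists (- q (- v)) => _ [w' [c' [/Kq Kq' ->]]].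
have [qD _] := qs.
by have := qD (v + w') (- v); rewrite addrAC subrr add0r; lra.
Qed.

Lemma inf_convolution_ge v m : (forall w c, K w c -> m <= q (v + w) - c) ->
  m <= inf_convolution q K v.
Proof.
move=> h; apply: lb_le_inf.
  by have [K0 _ _] := Kc; exists (q (v + 0) - 0), 0, 0.
by move=> _ [w [c [Kwc ->]]]; exact: h.
Qed.

Lemma inf_convolution_le_base v : inf_convolution q K v <= q v.
Proof.
by have [K0 _ _] := Kc; have := inf_convolution_le v K0; rewrite addr0 subr0.
Qed.

Lemma sublinear_inf_convolution : sublinear (inf_convolution q K).
Proof.
have [qD qZ] := qs; have [K0 KD KZ] := Kc; split=> [u v|t v].
  rewrite -lerBlDr; apply: inf_convolution_ge => w c Kwc.
  rewrite lerBlDr -lerBlDl; apply: inf_convolution_ge => w' c' Kwc'.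
  rewrite lerBlDl.
  have := inf_convolution_le (u + v) (KD _ _ _ _ Kwc Kwc').
  by have := qD (u + w) (v + w'); rewrite addrACA; lra.
rewrite le_eqVlt => /orP[/eqP<-|t0].
  rewrite scale0r mul0r (le_trans (inf_convolution_le_base 0))//.
  by rewrite sublinear0.
rewrite -ler_pdivrMl//; apply: inf_convolution_ge => w c Kwc.
rewrite ler_pdivrMl// (le_trans (inf_convolution_le _ (KZ _ _ _ t0 Kwc)))//.
by rewrite -scalerDr mulrBr lerD2r qZ// ltW.
Qed.

End inf_convolution.

(** Zorn's lemma for the reversed pointwise order. A chain is bounded by its pointwise infimum,
    which is finite because a sublinear [g] below [p] satisfies [- p (- v) <= g v]. *)
Lemma minimal_sublinear p : sublinear p ->
  exists q, [/\ sublinear q, forall v, q v <= p v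
    & forall q', sublinear q' -> (forall v, q' v <= q v) -> q' = q].
Proof.
move=> ps; pose T := {q : X -> R | sublinear q /\ forall v, q v <= p v}.
pose ge (f g : T) := `[< forall v, sval g v <= sval f v >].
have [||||q qmin] := @Zorn T ge.
- by move=> f; apply/asboolP.
- move=> f g h /asboolP fg /asboolP gh; apply/asboolP => v.
  exact: le_trans (gh v) (fg v).
- move=> [f fP] [g gP] /asboolP/= fg /asboolP/= gf; apply: eq_exist => /=.
  by apply/funext => v; apply/eqP; rewrite eq_le fg gf.
- move=> A Atot; have [[f0 Af0]|A0] := pselect (A !=set0); last first.
    have pp : sublinear p /\ forall v, p v <= p v by split.
    by exists (exist _ p pp) => f Af; exfalso; apply: A0; exists f.
  pose m v := inf [set sval f v | f in A].
  have m_le f v : A f -> m v <= sval f v.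
    move=> Af; apply: ge_inf; last by exists f.
    exists (- p (- v)) => _ [[g [gs gp]] Ag <-] /=.
    by rewrite (le_trans _ (sublinearN v gs))// lerN2.
  have m_ge c v : (forall f, A f -> c <= sval f v) -> c <= m v.
    move=> h; apply: lb_le_inf; first by exists (sval f0 v), f0.
    by move=> _ [f Af <-]; exact: h.
  have mP : sublinear m /\ forall v, m v <= p v.
    split; last first.
      by move=> v; rewrite (le_trans (m_le f0 v Af0))//; case: (svalP f0).
    split=> [u v|t v t0].
      rewrite -lerBlDr; apply: (m_ge) => f Af; rewrite lerBlDr -lerBlDl.
      apply: m_ge => g Ag; rewrite lerBlDl.
      (* The pointwise smaller of [f] and [g] majorizes [m] at [u + v], and its own subadditivity
         concludes. *)
      have [|] := Atot f g Af Ag => /asboolP fg.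
        have [[gD _] _] := svalP g.
        by rewrite (le_trans (m_le _ _ Ag))// (le_trans (gD _ _))// lerD2r.
      have [[fD _] _] := svalP f.
      by rewrite (le_trans (m_le _ _ Af))// (le_trans (fD _ _))// lerD2l.
    move: t0; rewrite le_eqVlt => /orP[/eqP<-|t0].
      rewrite scale0r mul0r (le_trans (m_le f0 0 Af0))// sublinear0//.
      by case: (svalP f0).
    rewrite -ler_pdivrMl//; apply: m_ge => f Af; rewrite ler_pdivrMl//.
    have [[_ fZ] _] := svalP f.
    by rewrite (le_trans (m_le _ _ Af))// fZ// ltW.
  by exists (exist _ m mP) => f Af; apply/asboolP => v; exact: m_le.
case: q qmin => q [qs qp] qmin; exists q; split=> // q' q's q'q.
have q'P : sublinear q' /\ forall v, q' v <= p v.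
  by split=> // v; exact: le_trans (q'q v) (qp v).
by have := qmin (exist _ q' q'P) (asboolT q'q) => /(congr1 sval).
Qed.

(* By minimality [q] equals its inf-convolution with the ray through
   [(a, q a)], which says [q v <= q (v + a) - q a]. *)
Lemma minimal_sublinearD q : sublinear q ->
  (forall q', sublinear q' -> (forall v, q' v <= q v) -> q' = q) ->
  {morph q : u v / u + v}.
Proof.
move=> qs qmin v a; apply/eqP; rewrite eq_le; have [-> _] /= := qs.
pose K (w : X) (c : R) := exists2 t, 0 <= t & w = t *: a /\ c = t * q a.
have Kc : convex_cone K.
  split=> [|u b w c|t u b t0].
  - by exists 0; rewrite ?scale0r ?mul0r.
  - move=> [s s0 [-> ->]] [t t0 [-> ->]]; exists (s + t); first exact: addr_ge0.
    by rewrite scalerDl mulrDl.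
  - move=> [s s0 [-> ->]]; exists (t * s); first by rewrite mulr_ge0// ltW.
    by rewrite scalerA mulrA.
have Kq w c : K w c -> c <= q w by move=> [t t0 [-> ->]]; rewrite sublinearZ.
have qK := qmin _ (sublinear_inf_convolution qs Kc Kq)
  (inf_convolution_le_base qs Kc Kq).
have Ka : K a (q a) by exists 1; rewrite ?scale1r ?mul1r.
by have := inf_convolution_le qs Kq v Ka; rewrite qK lerBrDr.
Qed.

Lemma minimal_sublinear_linear q : sublinear q ->
  (forall q', sublinear q' -> (forall v, q' v <= q v) -> q' = q) ->
  linear (q : X -> R^o).
Proof.
move=> qs qmin; have qD := minimal_sublinearD qs qmin.
have qN v : q (- v) = - q v.
  by apply/eqP; rewrite -subr_eq0 opprK -qD addNr sublinear0.
move=> t u v; rewrite qD; congr (_ + _).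
have [t0|/ltW t0] := leP 0 t; first by rewrite sublinearZ.
by rewrite -[t]opprK scaleNr qN sublinearZ ?oppr_ge0// scaleNr.
Qed.

(* Mazur-Orlicz form of the Hahn-Banach theorem. *)
Lemma sublinear_sandwich p K : sublinear p -> convex_cone K ->
  (forall w c, K w c -> c <= p w) ->
  exists h : {linear X -> R^o},
    (forall v, h v <= p v) /\ (forall w c, K w c -> c <= h w).
Proof.
move=> ps Kc Kp.
have [q [qs qK qmin]] :=
  minimal_sublinear (sublinear_inf_convolution ps Kc Kp).
have [h hq] := linear_pack (minimal_sublinear_linear qs qmin).
exists h; split=> [v|w c Kwc].
  by rewrite hq (le_trans (qK v))// inf_convolution_le_base.
(* At [- w] the inf-convolution is at most [p 0 - c = - c], so [h (- w) <= - c]. *)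
have := le_trans (qK (- w)) (inf_convolution_le ps Kp (- w) Kwc).
by rewrite addNr (sublinear0 ps) sub0r -hq raddfN lerN2.
Qed.

End sublinear_theory.

(** * The Bishop-Phelps maximality principle *)

(** Zorn's lemma for the order [rel], in which a move of length [d] must raise [f] by at least
    [k * d]. As [f] is bounded on [C], chains are Cauchy; their limits stay in the closed set [C]
    and are upper bounds. *)
Lemma bishop_phelps_maximal (R : realType) (X : completeNormedModType R)
    (C : set X) (f : X -> R^o) (k M : R) (x : X) :
  0 < k -> closed C -> continuous f -> (forall y, C y -> f y <= M) -> C x ->
  exists z, [/\ C z, k * `|z - x| <= f z - f x
    & forall y, C y -> f y - f z <= k * `|y - z|].
Proof.
move=> k0 Ccl fc CM Cx.
pose rel a y := k * `|y - a| <= f y - f a.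
have rel_refl a : rel a a by rewrite /rel !subrr normr0 mulr0.
have rel_trans b a c : rel a b -> rel b c -> rel a c.
  move=> ab bc; rewrite /rel.
  have h : `|c - a| <= `|c - b| + `|b - a|.
    by rewrite (le_trans _ (ler_normD _ _))// addrA subrK.
  by have := ler_wpM2l (ltW k0) h; move: ab bc; rewrite /rel mulrDr; lra.
have rel_anti a b : rel a b -> rel b a -> a = b.
  rewrite /rel distrC => ab ba; apply/eqP; rewrite -subr_eq0 -normr_le0.
  by rewrite -(pmulr_rle0 _ k0); lra.
have rel_closed a : closed [set y | rel a y].
  have -> : [set y | rel a y] =
      (fun y => f y - f a - k * `|y - a|) @^-1` [set t | 0 <= t].
    by apply/funext => y; rewrite /= /rel; apply/propext; rewrite subr_ge0.
  apply: preimage_closed; last exact: closed_ge.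
  move=> y _; apply: cvgB; first by apply: cvgB; [exact: fc|exact: cvg_cst].
  apply: cvgMl_tmp; apply: cvg_norm; apply: cvgB; [exact: cvg_id|exact: cvg_cst].
pose T := {y : X | C y /\ rel x y}.
pose le (a b : T) := `[< rel (sval a) (sval b) >].
have [||||z zmax] := @Zorn T le.
- by move=> a; apply/asboolP.
- by move=> a b c /asboolP ab /asboolP bc; apply/asboolP; exact: rel_trans bc.
- by move=> [a aP] [b bP] /asboolP/= ab /asboolP/= ba; exact/eq_exist/rel_anti.
- move=> A Atot; have [[a0 Aa0]|A0] := pselect (A !=set0); last first.
    have xP : C x /\ rel x x by [].
    by exists (exist _ x xP) => a Aa; exfalso; apply: A0; exists a.
  pose tail (a : T) := [set sval b | b in [set b | A b /\ rel (sval a) (sval b)]].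
  pose F := filter_from A tail.
  have FF : Filter F.
    apply: filter_from_filter; first by exists a0.
    move=> a b Aa Ab; have [|] := Atot a b Aa Ab => /asboolP ab.
      exists b => // _ [c [Ac bc] <-].
      by split; exists c => //; split=> //; exact: rel_trans bc.
    exists a => // _ [c [Ac ac] <-].
    by split; exists c => //; split=> //; exact: rel_trans ac.
  have FP : ProperFilter F.
    by apply: filter_from_proper => a Aa; exists (sval a), a.
  have Fcauchy : cauchy F.
    apply/cauchy_exP => e e0.
    pose V := [set f (sval a) | a in A].
    have Vsup : has_sup V.
      split; first by exists (f (sval a0)), a0.
      by exists M => _ [a Aa <-]; apply: CM; case: (svalP a).
    (* Once [f (sval a)] is within [k * e] of the supremum along the chain, every later element is
       within [e] of [sval a]. *)
    have [_ [a Aa <-] fa] := sup_adherent (mulr_gt0 k0 e0) Vsup.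
    exists (sval a), a => // _ [b [Ab ab] <-].
    rewrite -ball_normE /= distrC -(ltr_pM2l k0) (le_lt_trans ab)//.
    rewrite ltrBlDr -ltrBlDl; apply: le_lt_trans fa; rewrite lerD2r.
    by apply: sup_upper_bound => //; exists b.
  have Fl := cauchy_cvg _ Fcauchy; set l := lim F in Fl.
  have Fmem (B : set X) b : A b -> closed B -> tail b `<=` B -> B l.
    move=> Ab Bcl bB; apply: (@closed_cvg _ _ F _ id B Bcl).
      by exists b.
    exact: Fl.
  have la a : A a -> rel (sval a) l.
    by move=> Aa; apply: (Fmem _ a Aa (rel_closed _)) => _ [b [_ ab] <-].
  have lP : C l /\ rel x l.
    split; first by apply: (Fmem C a0 Aa0 Ccl) => _ [b _ <-]; case: (svalP b).
    by apply: (Fmem _ a0 Aa0 (rel_closed x)) => _ [b _ <-]; case: (svalP b).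
  by exists (exist _ l lP) => a Aa; apply/asboolP; exact: la.
case: z zmax => z [Cz xz] zmax; exists z; split=> // y Cy.
rewrite leNgt; apply/negP => zy.
have yP : C y /\ rel x y by split=> //; exact: rel_trans (ltW zy).
have /(congr1 sval)/= yz := zmax (exist _ y yP) (asboolT (ltW zy)).
by move: zy; rewrite yz !subrr normr0 mulr0 ltxx.
Qed.

(** * Elementary properties of the operator norm *)

Section opnorm_theory.
Context (R : realType) (X Y : normedModType R).

Lemma bounded_operator_le (T : {linear X -> Y}) c :
  (forall v, `|T v| <= c * `|v|) -> bounded_operator T.
Proof.
move=> Tc; apply/linear_boundedP; near=> r => v.
rewrite (le_trans (Tc v))// ler_wpM2r//; near: r; apply: nbhs_pinfty_ge.
exact: num_real.
Unshelve. all: by end_near. Qed.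

Lemma opnorm_le (T : X -> Y) c :
  (forall v, `|v| <= 1 -> `|T v| <= c) -> opnorm T <= c.
Proof.
move=> Tc; apply: ge_sup; last by move=> _ [v v1 <-]; exact: Tc.
by exists `|T 0|, 0 => //; rewrite /unit_ball /= normr0 ler01.
Qed.

Lemma opnorm_ge1 (T : {linear X -> Y}) v :
  bounded_operator T -> `|v| <= 1 -> `|T v| <= opnorm T.
Proof.
move=> /linear_boundedP/pinfty_ex_gt0[c c0 Tc] v1.
apply: ub_le_sup; last by exists v.
exists c => _ [w w1 <-]; rewrite (le_trans (Tc w))//.
by rewrite -[leRHS]mulr1 ler_wpM2l// ltW.
Qed.

Lemma opnorm_ge (T : {linear X -> Y}) v :
  bounded_operator T -> `|T v| <= opnorm T * `|v|.
Proof.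
move=> Tb; have [->|v0] := eqVneq v 0; first by rewrite linear0 !normr0 mulr0.
rewrite -ler_pdivrMr ?normr_gt0//.
have := @opnorm_ge1 T (`|v|^-1 *: v) Tb.
rewrite linearZ/= !normrZ normfV normr_id mulVf ?normr_eq0// => /(_ (lexx _)).
by rewrite mulrC.
Qed.

End opnorm_theory.

(** * Quantitative Bishop-Phelps-Bollobas theorem for functionals *)

Section bishop_phelps_bollobas.
Context (R : realType) (X : completeNormedModType R).

(** Take [z] maximal in the unit ball. Then [f <= k * |.|] on the cone spanned by the ball
    translated by [- z], so Hahn-Banach gives a linear [h] below [k * |.|] everywhere and above [f]
    on that cone. Hence [g = f - h] is nonpositive on the cone, that is, largest over the ball at
    [z]. *)
Lemma phelps (f : {linear X -> R^o}) (k : R) (x : X) :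
  bounded_operator f -> 0 < k < opnorm f -> `|x| <= 1 ->
  exists z (g : {linear X -> R^o}),
    [/\ `|z| = 1, k * `|z - x| <= opnorm f - f x,
        forall v, `|g v| <= g z * `|v|
      & forall v, `|f v - g v| <= k * `|v|].
Proof.
move=> fb /andP[k0 kf] x1; set r := opnorm f in kf *.
have fle v : f v <= r * `|v| by rewrite (le_trans (ler_norm _))// opnorm_ge.
have fle1 v : `|v| <= 1 -> f v <= r.
  by move=> v1; rewrite (le_trans (ler_norm _))// opnorm_ge1.
have ball_cl : closed [set v : X | `|v| <= 1].
  apply: (@preimage_closed _ _ (fun v : X => `|v|) [set t | t <= 1]).
    by move=> v _; exact: norm_continuous.
  exact: closed_le.
have [z [z1 zx zmax]] := bishop_phelps_maximal k0 ball_cl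
  (bounded_linear_continuous fb) fle1 x1.
pose p (v : X) := k * `|v|.
have ps : sublinear p.
  split=> [u v|t v t0]; first by rewrite -mulrDr ler_pM2l// ler_normD.
  by rewrite /p normrZ ger0_norm// mulrCA.
(* The graph of [f] over the cone of all [t *: (y - z)] with [y] in the unit
   ball and [0 <= t], written so that no division by [t] is needed. *)
pose K (w : X) (c : R) := c = f w /\ exists t, `|w + t *: z| <= t.
have Kc : convex_cone K.
  split=> [|u a v b [-> [s su]] [-> [t tv]]|t u a t0 [-> [s su]]].
  - by split; [rewrite linear0|exists 0; rewrite scale0r addr0 normr0].
  - split; first by rewrite linearD.
    exists (s + t); rewrite scalerDl addrACA.
    by rewrite (le_trans (ler_normD _ _))// lerD.
  - split; first by rewrite linearZ.
    exists (t * s); rewrite -scalerA -scalerDr normrZ gtr0_norm//.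
    by rewrite ler_pM2l.
have Kp w c : K w c -> c <= p w.
  move=> [-> [t tw]]; have := le_trans (normr_ge0 _) tw.
  rewrite le_eqVlt => /orP[/eqP t0|t0].
    move: tw; rewrite -t0 scale0r addr0 normr_le0 => /eqP->.
    by rewrite linear0 /p normr0 mulr0.
  have := zmax (t^-1 *: (w + t *: z)).
  rewrite /= normrZ gtr0_norm ?invr_gt0// ler_pdivrMl// mulr1 => /(_ tw).
  rewrite scalerDr scalerK ?gt_eqF// addrK linearD/= addrK linearZ/= normrZ.
  by rewrite gtr0_norm ?invr_gt0// mulrCA ler_pM2l ?invr_gt0.
have [h [hp hK]] := sublinear_sandwich ps Kc Kp.
have [g gE] : exists g : {linear X -> R^o}, g =1 (fun v => f v - h v).
  apply: linear_pack => a u v.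
  by rewrite !linearP /GRing.scale /=; ring.
have gz v : g v <= g z * `|v|.
  have /hK : K (v - `|v| *: z) (f (v - `|v| *: z)).
    by split=> //; exists `|v|; rewrite subrK.
  by rewrite !linearB !linearZ /= !gE /GRing.scale /=; lra.
have gz' v : `|g v| <= g z * `|v|.
  by rewrite ler_norml gz andbT lerNl -linearN -[`|v|]normrN gz.
have fg v : `|f v - g v| <= k * `|v|.
  rewrite gE opprB addrC subrK ler_norml; apply/andP; split; last exact: hp.
  by rewrite lerNl -linearN -normrN; exact: hp.
(* As [f - g] has norm at most [k < opnorm f], [g] cannot vanish. With [g z] positive,
   [g z <= g z * |z|] then yields [|z| = 1]. *)
have gz0 : 0 < g z.
  have : r <= k + g z.
    apply: opnorm_le => v v1.
    rewrite -[f v](subrK (g v)) (le_trans (ler_normD _ _))// lerD//.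
      by rewrite (le_trans (fg v))// -[leRHS]mulr1 ler_pM2l.
    rewrite (le_trans (gz' v))// -[leRHS]mulr1 ler_wpM2l//.
    have : 0 <= g z * (1 + `|z|).
      by have := gz (- z); rewrite linearN normrN mulrDr mulr1; lra.
    by rewrite pmulr_lge0// ltr_pwDl.
  by move: kf; lra.
exists z, g; split=> //.
apply/eqP; rewrite eq_le z1 -(ler_pM2l gz0) mulr1; exact: gz.
by move: zx (fle1 _ z1); lra.
Qed.

(** Divide [g] by its norm [m = g z]. The norms of [f] and [g] differ by at most [k], so this adds
    at most [|1 - m| <= k + (1 - r)] to the error [k]. *)
Lemma normalized_phelps (f : {linear X -> R^o}) (k : R) (x : X) :
  bounded_operator f -> 0 < k < opnorm f -> opnorm f <= 1 -> `|x| <= 1 ->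
  exists z (g : {linear X -> R^o}),
    [/\ `|z| = 1, g z = 1, k * `|z - x| <= opnorm f - f x,
        forall v, `|g v| <= `|v|
      & forall v, `|f v - g v| <= (2 * k + (1 - opnorm f)) * `|v|].
Proof.
move=> fb kf f1 x1; have [z [g [z1 zx gz fg]]] := phelps fb kf x1.
case/andP: kf => k0 kf; set r := opnorm f in kf f1 zx *.
have [m mE] : exists m : R, m = g z by exists (g z).
rewrite -mE in gz.
have fgz : `|(f z : R) - m| <= k by rewrite mE (le_trans (fg z))// z1 mulr1.
have fz : (f z : R) <= r by rewrite (le_trans (ler_norm _))// opnorm_ge1// z1.
have rm : r <= k + m.
  apply: opnorm_le => v v1.
  rewrite -[f v](subrK (g v)) (le_trans (ler_normD _ _))// lerD//.
    by rewrite (le_trans (fg v))// -[leRHS]mulr1 ler_pM2l.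
  rewrite (le_trans (gz v))// -[leRHS]mulr1 ler_wpM2l//.
  by have := le_trans (normr_ge0 _) (gz z); rewrite z1 mulr1.
have m0 : 0 < m by move: kf; lra.
have mk : `|1 - m| <= k + (1 - r).
  move: fgz; rewrite !ler_norml => /andP[fgz1 fgz2].
  by apply/andP; split; [move: f1 fz fgz1; lra|move: rm; lra].
have [g' g'E] : exists g' : {linear X -> R^o}, g' =1 (fun v => m^-1 * g v).
  by apply: linear_pack => a u v; rewrite !linearP /GRing.scale /=; ring.
have g'v v : `|g' v| <= `|v|.
  by rewrite g'E normrM gtr0_norm ?invr_gt0// ler_pdivrMl.
exists z, g'; split=> // [|v]; first by rewrite g'E -mE mulVf// gt_eqF.
have -> : f v - g' v = (f v - g v) - (1 - m) * g' v.
  by rewrite g'E; field; rewrite gt_eqF.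
rewrite (le_trans (ler_normB _ _))// normrM.
have := ler_pM (normr_ge0 (1 - m)) (normr_ge0 (g' v)) mk (g'v v).
by move: (fg v); lra.
Qed.

Lemma bpb_functional (f : {linear X -> R^o}) (eps k : R) (x : X) :
  bounded_operator f -> opnorm f <= 1 -> `|x| <= 1 -> 0 < eps < 1 ->
  1 - eps < `|f x| -> eps / 2 <= k < 1 ->
  exists z (g : {linear X -> R^o}),
    [/\ `|z| = 1, `|g z| = 1, `|x - z| <= eps / k, forall v, `|g v| <= `|v|
      & forall v, `|f v - g v| <= 2 * k * `|v|].
Proof.
move=> fb f1 x1 /andP[e0 e1] fx /andP[ek k1].
wlog fx0 : x x1 fx / 0 <= f x.
  move=> H; have [|fx0] := leP 0 (f x); first exact: H.
  have [||| z [g [z1 gz zx g1 fg]]] := H (- x).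
  - by rewrite normrN.
  - by rewrite linearN normrN.
  - by rewrite linearN oppr_ge0 ltW.
  exists (- z), g; split=> //; rewrite ?linearN ?normrN//.
  by rewrite opprK addrC -normrN opprD addrC.
rewrite ger0_norm// in fx.
have fxr : f x <= opnorm f by rewrite (le_trans (ler_norm _))// opnorm_ge1.
have k0 : 0 < k by move: ek; lra.
set r := opnorm f in f1 fxr *.
(* Chosen so that [2 * k1' + (1 - r) = 2 * k]. The smaller parameter is paid for by the smaller
   deficit [r - f x < eps - (1 - r)]; the balance is the inequality
   [0 <= (1 - r) * (k - eps / 2)]. *)
pose k1' := k - (1 - r) / 2.
have [k'r|rk'] := ltP k1' r.
  have k'0 : 0 < k1' by rewrite /k1'; lra.
  have [|z [g [z1 gz zx g1 fg]]] := @normalized_phelps f k1' x fb _ f1 x1.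
    by rewrite k'0.
  exists z, g; split=> // [||v]; first by rewrite gz normr1.
    rewrite distrC -(ler_pM2l k'0) (le_trans zx)// mulrA ler_pdivlMr//.
    have h1 : (r - f x) * k <= (r - 1 + eps) * k.
      by rewrite ler_wpM2r ?ltW//; move: fx; lra.
    have h2 : 0 <= (1 - r) * (k - eps / 2) by rewrite mulr_ge0// subr_ge0.
    by rewrite (le_trans h1)// /k1'; move: h2; lra.
  rewrite (le_trans (fg v))// ler_wpM2r//.
  by rewrite /k1' -/r; lra.
(* Here [1 + r <= 2 * k], so any norm one [g] is close enough to [f]. *)
pose k2 := k * (r - 1 + eps) / eps.
have k20 : 0 < k2.
  by rewrite divr_gt0// mulr_gt0//; lra.
(* With [k2] the displacement bound [(r - 1 + eps) / k2] is [eps / k]. It lies below [r] because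
   [r - 1 + eps <= eps * r] and [k < 1]. *)
have k2r : k2 < r.
  by rewrite ltr_pdivrMr//; nra.
have [|z [g [z1 gz zx g1 fg]]] := @normalized_phelps f k2 x fb _ f1 x1.
  by rewrite k20.
exists z, g; split=> // [||v]; first by rewrite gz normr1.
  rewrite distrC -(ler_pM2l k20) (le_trans zx)//.
  have -> : k2 * (eps / k) = r - 1 + eps by rewrite /k2; field; rewrite !gt_eqF.
  by rewrite -/r; lra.
rewrite (le_trans (ler_normB _ _))//.
have := opnorm_ge v fb; rewrite -/r => fv.
have : (1 + r) * `|v| <= 2 * k * `|v|.
  by rewrite ler_wpM2r//; move: rk'; rewrite /k1'; lra.
by move: (g1 v); lra.
Qed.

End bishop_phelps_bollobas.

(** * Norm-attaining operators into a space with property beta *)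

Section property_beta_operators.
Context (R : realType) (X Y : normedModType R) (rho : R) (L : Type)
  (y : L -> Y) (ys : L -> {linear Y -> R^o}).
Hypothesis rho01 : 0 <= rho < 1.
Hypothesis y_ys : forall a, unit_sphere Y (y a) /\ op_sphere Y R^o (ys a).
Hypothesis ysy1 : forall a, ys a (y a) = 1.
Hypothesis ysy : forall a c, a <> c -> `|ys a (y c)| <= rho.
Hypothesis normE : forall v, `|v| = sup [set `|ys a v| | a in [set: L]].

Lemma beta_functional_le a v : `|ys a v| <= `|v|.
Proof.
have [_ [ysb ys1]] := y_ys a.
by have := opnorm_ge v ysb; rewrite ys1 mul1r.
Qed.

Lemma beta_norm_le v c : 0 <= c -> (forall a, `|ys a v| <= c) -> `|v| <= c.
Proof.
move=> c0 vc; rewrite normE; have [[a _]|noL] := pselect ([set: L] !=set0).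
  by apply: ge_sup; [exists `|ys a v|, a|move=> _ [b _ <-]].
(* Without indices the supremum is [sup set0 = 0], and [0 <= c] concludes. *)
suff -> : [set `|ys a v| | a in [set: L]] = set0 by rewrite sup0.
by apply/seteqP; split=> // t [b _ _]; exfalso; apply: noL; exists b.
Qed.

Lemma beta_norm_gt v c : 0 <= c -> c < `|v| -> exists a, c < `|ys a v|.
Proof.
move=> c0 cv; apply: contrapT => nex.
suff : `|v| <= c by rewrite leNgt cv.
apply: beta_norm_le => // a; rewrite leNgt; apply/negP => ca.
by apply: nex; exists a.
Qed.

(* The perturbation [(1 + eta) g - y*_a T] along [y_a] makes the [a]-th
   coordinate equal to [(1 + eta) g]; the value of [eta] is the least one for
   which every other coordinate is still at most [1 + eta]. *)
Lemma beta_norm_attaining (T : {linear X -> Y}) (g : {linear X -> R^o})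
    (a : L) (z : X) (d : R) :
  (forall v, `|T v| <= `|v|) -> (forall v, `|g v| <= `|v|) ->
  `|z| = 1 -> `|g z| = 1 -> 0 <= d ->
  (forall v, `|ys a (T v) - g v| <= d * `|v|) ->
  exists F : {linear X -> Y},
    [/\ op_sphere X Y F, `|F z| = 1, forall v, `|F v| <= `|v|
      & forall B, d <= B -> 2 * rho * d <= B * (1 - rho) ->
          forall v, `|T v - F v| <= B * `|v|].
Proof.
move=> T1 g1 z1 gz1 d0 Tg; case/andP: rho01 => rho0 rho1.
have rho1' : 0 < 1 - rho by rewrite subr_gt0.
pose eta := rho * d / (1 - rho).
have eta0 : 0 <= eta by rewrite divr_ge0 ?mulr_ge0// ltW.
(* [eta] is the fixed point of [t = rho * (d + t)], where [d + eta] bounds the norm of [w]. *)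
have etaE : (d + eta) * rho = eta by rewrite /eta; field; rewrite gt_eqF.
have eta1 : 0 < 1 + eta by rewrite ltr_pwDl.
pose w v : R := (1 + eta) * g v - ys a (T v).
have [F FE] : exists F : {linear X -> Y},
    F =1 (fun v => (1 + eta)^-1 *: (T v + w v *: y a)).
  apply: linear_pack => t u v.
  have -> : w (t *: u + v) = t * w u + w v.
    by rewrite /w !linearP /GRing.scale /=; ring.
  rewrite linearP scalerDl -scalerA addrACA -scalerDr.
  by rewrite [LHS]scalerDr; congr (_ + _); rewrite !scalerA mulrC.
have wle v : `|w v| <= (d + eta) * `|v|.
  have -> : w v = eta * g v - (ys a (T v) - g v) by rewrite /w; ring.
  rewrite (le_trans (ler_normB _ _))// addrC mulrDl lerD//.
  by rewrite normrM ger0_norm// ler_wpM2l.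
have ysF b v : ys b (F v) = (1 + eta)^-1 * (ys b (T v) + w v * ys b (y a)).
  by rewrite FE linearZ linearD linearZ.
have ysFa v : ys a (F v) = g v.
  rewrite ysF ysy1 /w; field; exact: lt0r_neq0.
have wyle b v : b <> a -> `|w v * ys b (y a)| <= eta * `|v|.
  move=> ba; rewrite normrM -etaE mulrAC ler_pM//; exact: ysy.
have Tle b v : `|ys b (T v)| <= `|v|.
  by rewrite (le_trans (beta_functional_le b _)).
have F1 v : `|F v| <= `|v|.
  apply: beta_norm_le => // b; have [->|ba] := pselect (b = a).
    by rewrite ysFa.
  rewrite ysF normrM gtr0_norm ?invr_gt0// ler_pdivrMl//.
  by rewrite (le_trans (ler_normD _ _))// [leRHS]mulrDl mul1r lerD// wyle.
have Fz1 : `|F z| = 1.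
  apply/eqP; rewrite eq_le -{1}z1 F1/= -gz1 -ysFa.
  exact: beta_functional_le.
have Fb : bounded_operator F.
  by apply: (bounded_operator_le (c := 1)) => v; rewrite mul1r.
exists F; split=> //.
  split=> //; apply/eqP; rewrite eq_le; apply/andP; split.
    by apply: opnorm_le => v; apply: le_trans.
  by rewrite -[leLHS]Fz1; apply: opnorm_ge1 => //; rewrite z1.
move=> B dB rhoB v.
have B0 : 0 <= B by exact: le_trans dB.
apply: beta_norm_le => [|b]; first exact: mulr_ge0.
have [->|ba] := pselect (b = a).
  by rewrite linearB ysFa (le_trans (Tg v))// ler_wpM2r.
rewrite linearB ysF.
(* Both terms in the bracket are at most [eta * |v|], so this coordinate of [T - F] costs at most
   [2 * eta], which the second condition on [B] bounds by [B]. *)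
have -> : ys b (T v) - (1 + eta)^-1 * (ys b (T v) + w v * ys b (y a)) =
    (1 + eta)^-1 * (eta * ys b (T v) - w v * ys b (y a)).
  by field; exact: lt0r_neq0.
rewrite normrM gtr0_norm ?invr_gt0// ler_pdivrMl//.
rewrite (le_trans (ler_normB _ _))//.
have h1 : `|eta * ys b (T v)| <= eta * `|v|.
  by rewrite normrM ger0_norm// ler_wpM2l.
have h2 : 2 * eta <= B.
  by rewrite /eta !mulrA ler_pdivrMr.
have h3 : 2 * eta * `|v| <= B * `|v| by rewrite ler_wpM2r.
have h4 : 0 <= eta * (B * `|v|) by rewrite mulr_ge0// mulr_ge0.
by move: (wyle b v ba); lra.
Qed.

End property_beta_operators.

(** * Bounds on the two moduli *)

Lemma bpb_spherical_modulus_le (R : realType) (X Y : normedModType R) (eps : R) :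
  (bpb_spherical_modulus X Y eps <= bpb_modulus X Y eps)%E.
Proof.
apply: ereal_inf_le_tmp => _ [d [d0 H] <-]; exists d => //.
split=> // x T x1 [Tb T1].
by apply: H; [rewrite /unit_ball /= x1|split=> //; rewrite T1].
Qed.

(* With [k := eps / M] the radius [eps / k] is [M]; and [M <= 2] is exactly the
   condition [eps / 2 <= k] of [bpb_functional]. *)
Lemma bpb_approximation (R : realType) (X : completeNormedModType R)
    (Y : normedModType R) (rho eps M : R) (x : X) (T : {linear X -> Y}) :
  property_beta Y rho -> 0 < eps < 1 -> eps < M <= 2 ->
  M = 2 \/ 2 * eps * (1 + rho) <= M ^+ 2 * (1 - rho) ->
  unit_ball X x -> op_ball X Y T -> 1 - eps < `|T x| ->
  exists (z : X) (F : {linear X -> Y}),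
    [/\ unit_sphere X z, op_sphere X Y F, `|F z| = 1,
        `|x - z| <= M & opnorm (T \- F) <= M].
Proof.
move=> [rho01 [L [y [ys [y_ys ysy1 ysy normE]]]]] eps01 /andP[epsM M2] HM x1.
move=> [Tb T1] Tx; have /andP[eps0 eps1] := eps01.
have M0 : 0 < M by exact: lt_trans epsM.
have Tle v : `|T v| <= `|v|.
  by rewrite (le_trans (opnorm_ge v Tb))// -[leRHS]mul1r ler_wpM2r.
have [|a yTx] := beta_norm_gt normE _ Tx; first by rewrite subr_ge0 ltW.
have [f fE] : exists f : {linear X -> R^o}, f =1 (fun v => ys a (T v)).
  by apply: linear_pack => t u v; rewrite !linearP.
have fle v : `|f v| <= `|v|.
  by rewrite fE (le_trans (beta_functional_le y_ys a _)).
have fb : bounded_operator f.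
  by apply: (bounded_operator_le (c := 1)) => v; rewrite mul1r.
have f1 : opnorm f <= 1 by apply: opnorm_le => v; exact: le_trans.
have k12 : eps / 2 <= eps / M < 1.
  by rewrite ler_pM2l// lef_pV2 ?posrE// M2 ltr_pdivrMr// mul1r.
rewrite -fE in yTx.
have [z [g [z1 gz xz g1 fg]]] := bpb_functional fb f1 x1 eps01 yTx k12.
have d0 : 0 <= 2 * (eps / M) by rewrite mulr_ge0// divr_ge0// ltW.
have [|F [Fs Fz F1 FB]] :=
    beta_norm_attaining rho01 y_ys ysy1 ysy normE Tle g1 z1 gz d0 (a := a).
  by move=> v; rewrite -fE.
exists z, F; split=> //.
  by rewrite (le_trans xz)// invf_div mulrC divfK ?gt_eqF.
(* For [M = 2] the triangle inequality suffices. Otherwise [B = M] and [d = 2 * eps / M]: after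
   clearing denominators the conditions have left sides [2 * eps * (1 - rho)] and [4 * rho * eps],
   both at most [2 * eps * (1 + rho)]. *)
apply: opnorm_le => v v1 /=; case: HM => [->|HM].
  have := ler_normB (T v) (F v); have := Tle v; have := F1 v; lra.
have /andP[rho0 rho1] := rho01.
rewrite (le_trans (FB M _ _ v))//.
- rewrite mulrA ler_pdivrMr//; rewrite -(ler_pM2r (_ : 0 < 1 - rho)) ?subr_gt0//.
  rewrite -expr2 (le_trans _ HM)// ler_pM2l ?mulr_gt0//; lra.
- rewrite !mulrA ler_pdivrMr// [leRHS]mulrAC -expr2 (le_trans _ HM)//.
  have : 0 <= eps * (1 - rho) by rewrite mulr_ge0 ?subr_ge0 ?ltW.
  by lra.
- by rewrite -[leRHS]mulr1 ler_pM2l.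
Qed.

Unset Implicit Arguments.

Theorem theorem2p1 (R : realType) (rho : R) (hrho : 0 <= rho < 1)
    (X Y : completeNormedModType R) (hbeta : property_beta Y rho)
    (eps : R) (heps : 0 < eps < 1) :
  (bpb_spherical_modulus X Y eps <= bpb_modulus X Y eps)%E /\
  (bpb_modulus X Y eps <=
    (Num.min (Num.sqrt (2 * eps) * Num.sqrt ((1 + rho) / (1 - rho))) 2)%:E)%E.
Proof.
split; first exact: bpb_spherical_modulus_le.
have /andP[eps0 eps1] := heps; have /andP[rho0 rho1] := hrho.
rewrite -sqrtrM ?mulr_ge0 ?(ltW eps0)//.
set q := 2 * eps * _; set M := Num.min _ _.
have rho1' : 0 < 1 - rho by rewrite subr_gt0.
have q1 : 2 * eps <= q.
  by rewrite ler_peMr ?mulr_ge0 ?(ltW eps0)// ler_pdivlMr//; lra.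
(* This makes [eps / M < 1]; it holds since [eps ^+ 2 < 2 * eps <= q]. *)
have epsM : eps < M.
  rewrite lt_min; apply/andP; split; last by lra.
  rewrite -(gtr0_norm eps0) -sqrtr_sqr ltr_sqrt; last by lra.
  by rewrite (lt_le_trans _ q1)// expr2 ltr_pM2r//; lra.
have M2 : M <= 2 by rewrite ge_min lexx orbT.
have HM : M = 2 \/ 2 * eps * (1 + rho) <= M ^+ 2 * (1 - rho).
  have [q2|q2] := leP 2 (Num.sqrt q); first by left; exact/min_r.
  right; rewrite /M (min_l (ltW q2)) sqr_sqrtr; last by lra.
  by rewrite /q -[leRHS]mulrA divfK ?gt_eqF.
(* Admissibility asks for strict inequalities while the approximation gives [<= M], so [M + e] is
   shown admissible for every [e > 0]. *)
apply/lee_addgt0Pr => e e0; rewrite -EFinD; apply: ereal_inf_lbound.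
exists (M + e) => //; split; first by rewrite addr_gt0// (lt_trans eps0).
move=> x T x1 T1 Tx.
have [|z [F [z1 F1 Fz xz TF]]] :=
  bpb_approximation hbeta heps _ HM x1 T1 Tx; first by rewrite epsM.
by exists z, F; split=> //; rewrite (le_lt_trans _ (_ : M < M + e)) ?ltrDl.
Qed.
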